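(* Let $\mathcal{X}$ be a Polish space with its Borel $\sigma$-algebra, and let $\mathcal{P}$ and $\mathcal{P}_n$ ($n\ge 1$) be nonempty, weakly compact, convex sets of Borel probability measures on $\mathcal{X}$. Then $\lim_{n\to\infty}\mathrm{JS}(\mathcal{P}_n,\mathcal{P})=0$ if and only if $\lim_{n\to\infty}V(\mathcal{P}_n,\mathcal{P})=0$.
   Context: ''Weakly compact'' means compact in the topology of weak convergence of probability measures. For probability measures $\mu,\nu$: $\mathrm{KL}(\mu\parallel\nu)=\int_{\mathcal{X}}\log\left(\frac{d\mu}{d\nu}\right)d\mu$ (natural logarithm) if $\mu\ll\nu$, and $+\infty$ otherwise; $V(\mu,\nu)=\sup_{A}|\mu(A)-\nu(A)|$ over Borel sets $A$. For sets of probability measures: $\mathrm{KL}(\mathcal{P}\parallel\mathcal{Q}):=\sup_{\mu\in\mathcal{P}}\inf_{\nu\in\mathcal{Q}}\mathrm{KL}(\mu\parallel\nu)$; $V(\mathcal{P},\mathcal{Q}):=\max\left(\sup_{\mu\in\mathcal{P}}\inf_{\nu\in\mathcal{Q}}V(\mu,\nu),\ \sup_{\nu\in\mathcal{Q}}\inf_{\mu\in\mathcal{P}}V(\mu,\nu)\right)$; $\mathrm{JS}(\mathcal{P},\mathcal{Q}):=\frac12\mathrm{KL}(\mathcal{P}\parallel\mathcal{M})+\frac12\mathrm{KL}(\mathcal{Q}\parallel\mathcal{M})$ with $\mathcal{M}=\left\{\frac{\mu+\nu}{2}:\mu\in\mathcal{P},\nu\in\mathcal{Q}\right\}$. *)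

(* Defs.v *)
From HB Require Import structures.
From mathcomp Require Import all_boot all_order all_algebra.
From mathcomp Require Import all_classical all_reals all_analysis.

Set Implicit Arguments.
Unset Strict Implicit.
Unset Printing Implicit Defensive.

Import Order.TTheory GRing.Theory Num.Theory.
Import numFieldTopology.Exports numFieldNormedType.Exports.

Local Open Scope classical_set_scope.
Local Open Scope ring_scope.

Section polish.
Context (R : realType) (T : topologicalType).

Definition is_metric (d : T -> T -> R) : Prop :=
  [/\ forall x y, 0 <= d x y,
      forall x y, d x y = 0 <-> x = y,
      forall x y, d x y = d y x &
      forall x y z, d x z <= d x y + d y z].

Definition induces_topology (d : T -> T -> R) : Prop :=
  forall (x : T) (A : set T),
    nbhs x A <-> exists2 e : R, 0 < e & [set y | d x y < e] `<=` A.

Definition complete_metric (d : T -> T -> R) : Prop :=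
  forall u : nat -> T,
    (forall e : R, 0 < e ->
       exists N, forall m n, (N <= m)%N -> (N <= n)%N -> d (u m) (u n) < e) ->
    exists l : T, u @ \oo --> l.

Definition separable : Prop := exists2 S : set T, countable S & dense S.

Definition polish : Prop :=
  separable /\
  exists d, [/\ is_metric d, induces_topology d & complete_metric d].

End polish.

Notation borel T := (g_sigma_algebraType (@open T)).

Section weak_convergence.
Context (R : realType) (T : ptopologicalType).

Definition bounded_continuous : Type :=
  {f : T -> R | continuous f /\ [bounded f x | x in [set: T]]}.

Definition integral_map (mu : probability (borel T) R) :
  {ptws bounded_continuous -> R} := fun f => (\int[mu]_x sval f x)%R.

(* Probability measures are set functions defined also on non-measurable sets,
   so this topology separates them only up to equality on Borel sets. *)
Definition weak_probability : topologicalType := initial_topology integral_map.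

Definition weakly_compact (P : set (probability (borel T) R)) : Prop :=
  compact (P : set weak_probability).

End weak_convergence.

Section one_half.
Context (R : realType).

Let half_ge0 : 0 <= 2^-1 :> R.
Proof. by rewrite invr_ge0 ler0n. Qed.

Let half_le1 : 2^-1 <= 1 :> R.
Proof. by rewrite invf_le1 ?ltr0n// ler1n. Qed.

Definition one_half : {i01 R} := Itv01 half_ge0 half_le1.

End one_half.

Section mixture.
Context d (T : measurableType d) (R : realType).
Local Open Scope ereal_scope.

Section mixture_measure.
Variables (t : {i01 R}) (mu nu : probability T R).

Definition mixture (A : set T) : \bar R :=
  t%:num%:E * mu A + (1 - t%:num)%:E * nu A.

Let onem_t : (0 <= 1 - t%:num)%R.
Proof. by rewrite subr_ge0. Qed.

Let mixture_msum (A : set T) : mixture A =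
  measure_add (mscale (NngNum (ge0 t)) mu) (mscale (NngNum onem_t) nu) A.
Proof. by rewrite measure_addE. Qed.

Let mixture0 : mixture set0 = 0.
Proof. by rewrite /mixture !measure0 !mule0 adde0. Qed.

Let mixture_ge0 A : 0 <= mixture A.
Proof. by rewrite adde_ge0// mule_ge0// lee_fin. Qed.

Let mixture_sigma_additive : semi_sigma_additive mixture.
Proof.
by rewrite (funext mixture_msum); exact: measure_semi_sigma_additive.
Qed.

HB.instance Definition _ := isMeasure.Build _ _ _ mixture
  mixture0 mixture_ge0 mixture_sigma_additive.

Let mixture_setT : mixture setT = 1.
Proof.
by rewrite /mixture !probability_setT !mule1 -EFinD addrC subrK.
Qed.

HB.instance Definition _ :=
  Measure_isProbability.Build _ _ _ mixture mixture_setT.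

End mixture_measure.

Definition convex_probabilities (P : set (probability T R)) : Prop :=
  forall (t : {i01 R}) mu nu, P mu -> P nu -> P (mixture t mu nu).

Definition midpoints (P Q : set (probability T R)) : set (probability T R) :=
  [set (mixture (one_half R) mu nu : probability T R) | mu in P & nu in Q].

End mixture.

Section divergences.
Context d (T : measurableType d) (R : realType).
Local Open Scope ereal_scope.
Local Open Scope charge_scope.
Implicit Types (mu nu : probability T R) (P Q : set (probability T R)).

(* The density is determined up to a [nu]-null set and is positive [mu]-almost
   everywhere, so the values of [lne] at nonpositive reals are irrelevant. The
   negative part of the integrand is [mu]-integrable, so no [+oo - +oo] occurs
   in the integral. *)
Definition KL mu nu : \bar R :=
  if `[< mu `<< nu >]
  then \int[mu]_x lne (('d (charge_of_finite_measure mu) '/d nu) x)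
  else +oo.

Definition TV mu nu : \bar R :=
  ereal_sup [set `|mu A - nu A| | A in measurable].

Definition KL_set P Q : \bar R :=
  ereal_sup [set ereal_inf [set KL mu nu | nu in Q] | mu in P].

Definition TV_set P Q : \bar R :=
  maxe (ereal_sup [set ereal_inf [set TV mu nu | nu in Q] | mu in P])
       (ereal_sup [set ereal_inf [set TV mu nu | mu in P] | nu in Q]).

Definition JS_set P Q : \bar R :=
  (2^-1 : R)%R%:E * KL_set P (midpoints P Q) +
  (2^-1 : R)%R%:E * KL_set Q (midpoints P Q).

End divergences.

(* Main.v *)
Require Import Defs.
From mathcomp Require Import all_boot all_order all_algebra.
From mathcomp Require Import all_classical all_reals all_analysis.
From mathcomp Require Import ring lra.
Import measurable_realfun.

Set Implicit Arguments.
Unset Strict Implicit.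
Unset Printing Implicit Defensive.

Import Order.TTheory GRing.Theory Num.Theory.
Import numFieldTopology.Exports numFieldNormedType.Exports.

Local Open Scope classical_set_scope.
Local Open Scope ring_scope.

(** Write [V] for the total variation distance and [m = (mu + nu) / 2] for a
    midpoint. The equivalence follows from two quantitative bounds between
    [JS_set] and [TV_set].

    Upper bound, [JS_set P Q <= TV_set P Q]. Since [mu <= 2 m], the density
    [r] of [mu] with respect to [m] satisfies
    [KL (mu || m) <= int_{r >= 1} (r - 1) dmu <= 2 int_{r >= 1} (r - 1) dm],
    and the last integral is [mu A - m A] for [A = {r >= 1}]; hence
    [KL (mu || m) <= 2 V (mu, m) = V (mu, nu)] ([KL_le_TV],
    [KL_midpoint_le_TV]). Taking [mu] in [P] and [nu] in [Q] close to each
    other, the midpoint is an element of the set of midpoints that is close to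
    both of them in the sense of [KL].

    Lower bound, [JS_set P Q <= s^2] implies [TV_set P Q <= 9 s]. A weak form
    of Pinsker's inequality ([KL_ge], [TV_le_KL]), obtained by testing [KL]
    against the function [1 + s 1_A], shows that every [mu] in [P] is within
    [4 s] of some midpoint [(mu' + nu') / 2] with [mu'] in [P] and [nu'] in
    [Q]. This says nothing yet about the distance from [mu] to [Q], because
    [mu'] is in [P]. But if [mu'] is within [d] of some [nu''] in [Q], then
    [(nu'' + nu') / 2] belongs to [Q] by convexity and is within [4 s + d / 2]
    of [mu]. So a bound [d] on the distances from the points of [P] to [Q]
    improves to [4 s + d / 2]; iterating from the trivial bound [d = 1] gives
    [8 s + 2^-k] for every [k] ([approx_by_halving]). The roles of [P] and
    [Q] can be exchanged. *)

(** * A real density for the Kullback-Leibler divergence *)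

Section density.
Context d (T : measurableType d) (R : realType).
Local Open Scope ereal_scope.
Local Open Scope charge_scope.

(** An integral is the difference of those of the positive and negative parts,
    and subtraction in [\bar R] is monotone even at infinite values. This lets the integrand of [KL] be compared with
    other functions before anything is known about the finiteness of [KL]. *)
Lemma le_integral_measurable (mu : {measure set T -> \bar R}) (D : set T)
    (h k : T -> \bar R) :
  measurable D -> measurable_fun D h -> measurable_fun D k ->
  (forall x, D x -> h x <= k x) ->
  \int[mu]_(x in D) h x <= \int[mu]_(x in D) k x.
Proof.
move=> mD mh mk hk; rewrite [leLHS]integralE [leRHS]integralE leeB//.
- apply: ge0_le_integral => //; [exact: measurable_funepos..|].
  move=> x Dx; apply: (@funepos_le _ _ D); last exact/mem_set.
  by move=> y /set_mem/hk.
- apply: ge0_le_integral => //; [exact: measurable_funeneg..|].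
  move=> x Dx; apply: (@funeneg_le _ _ D); last exact/mem_set.
  by move=> y /set_mem/hk.
Qed.

Lemma measurable_lneEFin (r : T -> R) : measurable_fun [set: T] r ->
  measurable_fun [set: T] (fun x => lne (r x)%:E).
Proof.
move=> mr; apply: measurable_fun_ifT => //.
- exact: measurable_fun_ler.
- by apply/measurable_EFinP; exact: measurableT_comp.
Qed.

(** The Radon-Nikodym derivative in the definition of [KL] is that of a charge,
    hence only almost everywhere nonnegative. Replacing it by an everywhere
    nonnegative real density [r], which equals it almost everywhere, turns [KL]
    into an integral of the real-valued [ln], restricted to the set of full
    [mu]-measure where [r] is positive. *)
Lemma KL_density (mu m : probability T R) : mu `<< m ->
  exists r : T -> R, [/\ measurable_fun [set: T] r,
    forall x, (0 <= r x)%R,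
    forall (h : T -> \bar R) (E : set T), measurable E ->
      measurable_fun E h -> (forall x, 0 <= h x) ->
      \int[m]_(x in E) (h x * (r x)%:E) = \int[mu]_(x in E) h x,
    mu [set x | (0 < r x)%R] = 1 &
    KL mu m = \int[mu]_(x in [set x | (0 < r x)%R]) (ln (r x))%:E].
Proof.
move=> mum.
set g := Radon_Nikodym_SigmaFinite.f mu m.
have gfin x : g x \is a fin_num by exact: Radon_Nikodym_SigmaFinite.f_fin_num.
have g0 x : 0 <= g x by exact: Radon_Nikodym_SigmaFinite.f_ge0.
have mg : measurable_fun [set: T] g.
  exact: measurable_int (Radon_Nikodym_SigmaFinite.f_integrable mum).
pose r x := fine (g x).
have rE x : (r x)%:E = g x by rewrite fineK.
have r0 x : (0 <= r x)%R by rewrite fine_ge0.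
have mr : measurable_fun [set: T] r by exact: measurableT_comp.
have mD : measurable [set x | (0 < r x)%R].
  by rewrite -[X in measurable X]setTI; exact: measurable_fun_ltr.
have cov (h : T -> \bar R) (E : set T) : measurable E ->
    measurable_fun E h -> (forall x, 0 <= h x) ->
    \int[m]_(x in E) (h x * (r x)%:E) = \int[mu]_(x in E) h x.
  move=> mE mh h0; under eq_integral do rewrite rE.
  exact: Radon_Nikodym_SigmaFinite.change_of_variables.
have muN : mu (~` [set x | (0 < r x)%R]) = 0.
  rewrite (Radon_Nikodym_SigmaFinite.f_integral mum); last exact: measurableC.
  apply: integral0_eq => x /= /negP; rewrite -leNgt => rx.
  by rewrite -/g -rE; apply/eqP; rewrite eqe eq_le rx r0.
exists r; split => //.
  rewrite -(setCK [set x | _]) probability_setC ?muN ?sube0//.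
  exact: measurableC.
rewrite /KL; case: asboolP => // _.
rewrite [RHS]integral_mkcond; apply: ae_eq_integral => //.
- rewrite (_ : (fun x => _) = fun x =>
      lne (fine (('d (charge_of_finite_measure mu) '/d m) x))%:E).
    by apply: measurable_lneEFin; exact: measurableT_comp.
  by apply/funext => x; rewrite fineK// Radon_Nikodym_fin_num.
- apply/(measurable_restrictT _ mD)/measurable_EFinP/measurable_funTS.
  exact: measurableT_comp.
have gae : ae_eq mu setT g ('d (charge_of_finite_measure mu) '/d m).
  apply: (null_dominates_ae_eq measurableT mum).
  exact: ae_eq_Radon_Nikodym_SigmaFinite.
have rae : \forall x \ae mu, (0 < r x)%R.
  by exists (~` [set x | (0 < r x)%R]); split => //; exact: measurableC.
apply: filterS2 gae rae => x /(_ Logic.I) <- rx _.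
by rewrite -rE lne_EFin// patchE mem_set.
Qed.
End density.

(** * Comparison of Kullback-Leibler divergence and total variation *)

Section divergence_bounds.
Context d (T : measurableType d) (R : realType).
Local Open Scope ereal_scope.
Implicit Types mu nu m : probability T R.

Lemma TV_leP mu nu (e : \bar R) :
  TV mu nu <= e <-> forall A, measurable A -> `|mu A - nu A| <= e.
Proof.
split=> [le_e A mA|le_e]; last first.
  by apply: ge_ereal_sup => _ [A /= mA <-]; exact: le_e.
by apply: le_trans le_e; apply: ereal_sup_ubound; exists A.
Qed.

Lemma le_TV mu nu A : measurable A -> `|mu A - nu A| <= TV mu nu.
Proof. by move: A; apply/TV_leP. Qed.

(** On [A = {r >= 1}] one has [ln r <= r - 1], and off [A] the logarithm is
    nonpositive, so [KL mu m <= int_A (r - 1) dmu]. The integrand is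
    nonnegative on [A], so domination replaces [dmu] by [c dm], and
    [int_A (r - 1) dm = mu A - m A]. *)
Lemma KL_le_TV (c : R) mu m : (0 <= c)%R ->
  (forall A, measurable A -> mu A <= c%:E * m A) -> KL mu m <= c%:E * TV mu m.
Proof.
move=> c0 mu_cm.
have mum : mu `<< m.
  apply/null_content_dominatesP => A mA mA0; apply/eqP.
  by rewrite -measure_le0; have := mu_cm A mA; rewrite mA0 mule0.
have [r [mr r0 cov _ ->]] := KL_density mum.
pose A := [set x | (1 <= r x)%R].
have mA : measurable A.
  by rewrite -[X in measurable X]setTI; exact: measurable_fun_ler.
have mD : measurable [set x | (0 < r x)%R].
  by rewrite -[X in measurable X]setTI; exact: measurable_fun_ltr.
pose h x := maxe (r x - 1)%:E 0.
have h0 x : 0 <= h x by rewrite le_max lexx orbT.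
have mh : measurable_fun [set: T] h.
  by apply: measurable_maxe => //; apply/measurable_EFinP; exact: measurable_funB.
apply: (@le_trans _ _ (\int[mu]_(x in A) h x)).
  have -> : A = [set x | (0 < r x)%R] `&` A.
    by apply/esym/setIidPr => x /=; exact: lt_le_trans.
  rewrite integral_mkcondr; apply: le_integral_measurable => //.
  - by apply/measurable_EFinP; apply: measurable_funTS; exact: measurableT_comp.
  - apply: measurable_funTS; apply/(measurable_restrictT _ mA).
    exact: measurable_funTS.
  move=> x /= rx; rewrite patchE; case: ifPn => [_|].
    rewrite /h le_max; apply/orP; left; rewrite lee_fin.
    have -> : (r x = 1 + (r x - 1))%R by lra.
    by rewrite (le_trans (le_ln1Dx _))//; lra.
  rewrite notin_setE /A/= => /negP; rewrite -ltNge => r1.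
  by rewrite lee_fin ln_le0// ltW.
apply: (@le_trans _ _ (c%:E * \int[m]_(x in A) h x)).
  pose k := NngNum c0.
  rewrite -[c]/(k%:num) -ge0_integral_mscale//; last exact: measurable_funTS.
  exact: ge0_le_measure_integral.
apply: lee_wpmul2l; first by rewrite lee_fin.
have hA : \int[m]_(x in A) h x + m A = mu A.
  have -> : mu A = \int[mu]_(x in A) cst 1 x by rewrite integral_cst// mul1e.
  rewrite -cov// -[m A]mul1e -integral_cst// -ge0_integralD//; last first.
    exact: measurable_funTS.
  apply: eq_integral => x /set_mem rx.
  by rewrite mul1e /h max_l ?lee_fin ?subr_ge0// -EFinD subrK.
have -> : \int[m]_(x in A) h x = mu A - m A.
  by rewrite -hA addeK// fin_num_measure.
apply: (le_trans (lee_abs _)).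
exact: le_TV.
Qed.

(** Let [w = 1 + s 1_A]. The inequality [ln z <= z - 1] at [z = w / r] reads
    [ln r >= ln w + 1 - w / r]. Integrating it against [mu], the last term
    becomes at most [int w dm = 1 + s m A], and
    [ln (1 + s) >= s / (1 + s)] bounds the first one from below. *)
Lemma KL_ge (s : R) mu m (A : set T) : (0 < s)%R -> measurable A ->
  (s / (1 + s))%:E * mu A - s%:E * m A <= KL mu m.
Proof.
move=> s0 mA.
have [mum|] := pselect (mu `<< m); last first.
  by rewrite /KL; case: asboolP => // _ _; rewrite leey.
have [r [mr r0 cov muD ->]] := KL_density mum.
set D := [set x | (0 < r x)%R] in muD *.
have mD : measurable D.
  by rewrite -[X in measurable X]setTI; exact: measurable_fun_ltr.
pose w x : R := (1 + s * \1_A x)%R.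
have w0 x : (0 < w x)%R.
  by rewrite ltr_wpDr// mulr_ge0// ltW.
pose a x : R := (s / (1 + s) * \1_A x)%R.
(* [q] is [w / r] where [r] is positive; this form is visibly measurable. *)
pose q x : R := (w x * expR (- ln (r x)))%R.
have mind : measurable_fun [set: T] (\1_A : T -> R) by exact: measurable_indic.
have mw : measurable_fun [set: T] w.
  by apply: measurable_funD => //; exact: measurable_funM.
have ma : measurable_fun [set: T] a by exact: measurable_funM.
have mq : measurable_fun [set: T] q.
  apply: measurable_funM => //; apply: measurableT_comp => //.
  by apply: measurableT_comp => //; exact: measurableT_comp.
have q0 x : (0 <= q x)%R by rewrite mulr_ge0 ?expR_ge0// ltW.
have a0 x : (0 <= a x)%R by rewrite mulr_ge0// divr_ge0// ltW// addr_gt0.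
have muA : \int[mu]_(x in D) (a x)%:E = (s / (1 + s))%:E * mu A.
  under eq_integral do rewrite EFinM.
  rewrite ge0_integralZl_EFin//.
  - congr (_ * _); rewrite integral_indic// [RHS](measureDI mu mA mD).
    suff AD0 : mu (A `\` D) = 0 by rewrite [X in _ = X + _]AD0 add0e.
    have muN : mu (~` D) = 0 by rewrite probability_setC// muD subee.
    apply/eqP; rewrite -measure_le0 -muN.
    apply: le_measure; rewrite ?inE; [|exact: measurableC|by move=> x []].
    exact: measurableD.
  - by apply/measurable_EFinP; exact: measurable_funTS.
  - by rewrite divr_ge0// ltW// addr_gt0.
have qw : \int[mu]_(x in D) (q x)%:E <= 1 + s%:E * m A.
  rewrite -cov//; last by apply/measurable_EFinP; exact: measurable_funTS.
  rewrite (eq_integral (fun x => (w x)%:E)); last first.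
    move=> x /set_mem rx; rewrite /q -EFinM -mulrA.
    rewrite -[X in (_ * (_ * X))%R](lnK rx) expRN mulVf ?mulr1//.
    by rewrite gt_eqF ?expR_gt0.
  apply: (@le_trans _ _ (\int[m]_x (w x)%:E)).
    apply: ge0_subset_integral => //; first exact/measurable_EFinP.
    by move=> x _; rewrite lee_fin ltW.
  under eq_integral do rewrite EFinD EFinM.
  rewrite ge0_integralD//; last 2 first.
    by move=> x _; rewrite mule_ge0// lee_fin ltW.
    by apply/measurable_EFinP; exact: measurable_funM.
  rewrite ge0_integralZl_EFin//; [|exact/measurable_EFinP|exact: ltW].
  rewrite integral_indic// setIT.
  have -> : \int[m]_(x in setT) 1%:E = 1.
    by rewrite integral_cst// mul1e; exact: probability_setT.
  by [].
have fin x (B : set T) : measurable B -> x%:E * m B \is a fin_num.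
  by move=> mB; rewrite fin_numM// fin_num_measure.
have iq : mu.-integrable D (EFin \o q).
  apply/integrableP; split.
    by apply/measurable_EFinP; exact: measurable_funTS.
  under eq_integral do rewrite /= ger0_norm//.
  by rewrite (le_lt_trans qw)// ltey_eq fin_numD fin.
have ia : mu.-integrable D (EFin \o a).
  apply/integrableP; split.
    by apply/measurable_EFinP; exact: measurable_funTS.
  under eq_integral do rewrite /= ger0_norm//.
  by rewrite muA ltey_eq fin_numM// fin_num_measure.
have i1 : mu.-integrable D (cst 1) by exact: finite_measure_integrable_cst.
have -> : (s / (1 + s))%:E * mu A - s%:E * m A =
          (s / (1 + s))%:E * mu A + 1 - (1 + s%:E * m A).
  rewrite -(fineK (fin_num_measure mu A mA)) -(fineK (fin_num_measure m A mA)).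
  by rewrite -!EFinM -!EFinD; congr _%:E; ring.
apply: (@le_trans _ _ (\int[mu]_(x in D) (((a x)%:E + 1) - (q x)%:E))).
  rewrite integralB//; last exact: integrableD.
  rewrite integralD// muA leeB// leeD2l//.
  by rewrite integral_cst// mul1e -[leLHS]muD.
apply: le_integral_measurable => //.
- apply: measurable_funTS; apply/measurable_EFinP; apply: measurable_funB => //.
  exact: measurable_funD.
- by apply: measurable_funTS; apply/measurable_EFinP; exact: measurableT_comp.
move=> x rx; rewrite -!EFinD lee_fin.
have z0 : (0 < q x)%R by rewrite mulr_gt0 ?expR_gt0.
have lnq : (ln (q x) = ln (w x) - ln (r x))%R.
  by rewrite lnM ?posrE ?expR_gt0// expRK.
have aw : (a x <= ln (w x))%R.
  rewrite /a /w indicE; case: (x \in A); rewrite ?mulr0 ?addr0 ?ln1//= !mulr1.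
  have s1 : (0 < 1 + s)%R by rewrite addr_gt0.
  rewrite -[leRHS]opprK -lnV ?posrE// lerNr.
  have {1}-> : ((1 + s)^-1 = 1 + - (s / (1 + s)))%R by field; lra.
  by apply: le_ln1Dx; rewrite ltrN2 ltr_pdivrMr//; lra.
have : (ln (1 + (q x - 1)) <= q x - 1)%R by apply: le_ln1Dx; lra.
by rewrite [X in ln X]addrC subrK lnq; lra.
Qed.
End divergence_bounds.

(** * Total variation and mixtures *)

Section total_variation.
Context d (T : measurableType d) (R : realType).
Local Open Scope ereal_scope.
Implicit Types mu nu m : probability T R.

Let half_gt0 : (0 < 2^-1 :> R)%R. Proof. by rewrite invr_gt0. Qed.

Lemma TV_ge0 mu nu : 0 <= TV mu nu.
Proof.
by apply: ereal_sup_ubound; exists set0 => //; rewrite !measure0 subee// abse0.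
Qed.

Lemma TV_le1 mu nu : TV mu nu <= 1.
Proof.
apply/TV_leP => A mA; rewrite -(fineK (fin_num_measure mu A mA)).
rewrite -(fineK (fin_num_measure nu A mA)) -EFinB lee_fin ler_norml.
have : (0 <= fine (mu A) <= 1)%R.
  by rewrite fine_ge0//= -lee_fin fineK ?fin_num_measure// probability_le1.
have : (0 <= fine (nu A) <= 1)%R.
  by rewrite fine_ge0//= -lee_fin fineK ?fin_num_measure// probability_le1.
by move=> /andP[? ?] /andP[? ?]; apply/andP; split; lra.
Qed.

Lemma TV_sym mu nu : TV mu nu = TV nu mu.
Proof.
apply/eqP; rewrite eq_le; apply/andP; split; apply/TV_leP => A mA;
  by rewrite -abseN fin_num_oppeB ?fin_num_measure// addeC le_TV.
Qed.

Lemma TV_triangle m mu nu : TV mu nu <= TV mu m + TV m nu.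
Proof.
apply/TV_leP => A mA; apply: (@le_trans _ _ (`|mu A - m A| + `|m A - nu A|)).
  rewrite -(fineK (fin_num_measure mu A mA)) -(fineK (fin_num_measure nu A mA)).
  by rewrite -(fineK (fin_num_measure m A mA)) -!EFinB lee_fin ler_distD.
by apply: leeD; exact: le_TV.
Qed.

Lemma mixture_halfE mu nu (A : set T) :
  (mixture (one_half R) mu nu : probability T R) A =
  2^-1%:E * mu A + 2^-1%:E * nu A.
Proof.
rewrite /= /mixture; congr (_ + _%:E * _).
by have -> : ((one_half R)%:num = 2^-1)%R by []; lra.
Qed.

Lemma TV_mixture_half mu mu' nu :
  TV (mixture (one_half R) mu nu) (mixture (one_half R) mu' nu) <=
  2^-1%:E * TV mu mu'.
Proof.
apply/TV_leP => A mA; rewrite !mixture_halfE.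
apply: (@le_trans _ _ (2^-1%:E * `|mu A - mu' A|)); last first.
  apply: lee_wpmul2l; first by rewrite lee_fin ltW.
  exact: le_TV.
rewrite -(fineK (fin_num_measure mu A mA)) -(fineK (fin_num_measure nu A mA)).
rewrite -(fineK (fin_num_measure mu' A mA)) -!EFinM -!EFinD lee_fin.
by rewrite opprD addrACA subrr addr0 -mulrBr normrM gtr0_norm.
Qed.

Lemma TV_mixture_halfC m mu nu :
  TV m (mixture (one_half R) mu nu) = TV m (mixture (one_half R) nu mu).
Proof.
rewrite /TV; congr ereal_sup; apply: eq_imagel => A _.
by rewrite !mixture_halfE [X in _ - X]addeC.
Qed.

End total_variation.

(** * Divergences between convex sets *)

Section divergences_of_sets.
Context d (T : measurableType d) (R : realType).
Local Open Scope ereal_scope.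
Implicit Types (mu nu m : probability T R) (P Q : set (probability T R)).

Lemma KL_ge0 mu m : 0 <= KL mu m.
Proof.
have := KL_ge mu m ltr01 (@measurable0 _ T).
by rewrite !measure0 !mule0 sube0.
Qed.

(** A weak form of Pinsker's inequality: [s / (1 + s) >= s - s^2], so [KL_ge]
    gives [s (mu A - m A) <= KL mu m + s^2], and passing to the complement of
    [A] gives the absolute value. Choosing [s] of the order of the square root
    of [KL] recovers the usual rate up to a constant. *)
Lemma TV_le_KL (s k : R) mu m : (0 < s)%R -> KL mu m <= k%:E ->
  TV mu m <= (k / s + s)%:E.
Proof.
move=> s0 KLk; apply/TV_leP.
suff one_sided A : measurable A -> mu A - m A <= (k / s + s)%:E.
  move=> A mA; have := one_sided _ mA; have := one_sided _ (measurableC mA).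
  rewrite !probability_setC//.
  rewrite -(fineK (fin_num_measure mu A mA)) -(fineK (fin_num_measure m A mA)).
  by rewrite -!EFinD !lee_fin ler_norml => ? ?; apply/andP; split; lra.
move=> mA; have := le_trans (KL_ge mu m s0 mA) KLk.
have := probability_le1 mu mA.
have : 0 <= mu A by [].
rewrite -(fineK (fin_num_measure mu A mA)) -(fineK (fin_num_measure m A mA)).
rewrite -!EFinM -!EFinD !lee_fin => p0 p1 le_k.
rewrite -(ler_pM2l s0).
have -> : (s * (k / s + s) = k + s ^+ 2)%R by field; rewrite gt_eqF.
have : (s - s ^+ 2 <= s / (1 + s))%R.
  by rewrite ler_pdivlMr; nra.
by nra.
Qed.

(** The midpoint is described by its values so that the lemma applies to both
    endpoints of a mixture. *)
Lemma KL_midpoint_le_TV mu nu m :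
  (forall A, measurable A -> m A = 2^-1%:E * mu A + 2^-1%:E * nu A) ->
  KL mu m <= TV mu nu.
Proof.
move=> mE; apply: (@le_trans _ _ (2%:E * TV mu m)).
  apply: KL_le_TV => // A mA; rewrite mE//.
  rewrite -(fineK (fin_num_measure mu A mA)) -(fineK (fin_num_measure nu A mA)).
  rewrite -!EFinM lee_fin.
  have : (0 <= fine (nu A))%R by rewrite fine_ge0.
  by lra.
apply: (@le_trans _ _ (2%:E * (2^-1%:E * TV mu nu))); last first.
  by rewrite muleA -EFinM divff// mul1e.
apply: lee_wpmul2l => //; apply/TV_leP => A mA.
apply: (@le_trans _ _ (2^-1%:E * `|mu A - nu A|)); last first.
  apply: lee_wpmul2l; first by rewrite lee_fin.
  exact: le_TV.
rewrite mE// -(fineK (fin_num_measure mu A mA)) -(fineK (fin_num_measure nu A mA)).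
rewrite -!EFinM -!EFinD lee_fin.
set p := fine (mu A); set q := fine (nu A).
have -> : (p - (2^-1 * p + 2^-1 * q) = 2^-1 * (p - q))%R by field.
by rewrite normrM gtr0_norm.
Qed.

(** Each half of [JS_set] is bounded by half of the one-sided distance from the
    same set, since [nu] in the infimum over the other set can be traded for the
    midpoint of [mu] and [nu]. *)
Lemma JS_set_le_TV_set P Q : JS_set P Q <= TV_set P Q.
Proof.
have half_sum (x : \bar R) : 2^-1%:E * x + 2^-1%:E * x = x.
  by rewrite -ge0_muleDl ?lee_fin// -EFinD -div1r -splitr mul1e.
rewrite -[leRHS]half_sum; apply: leeD; apply: lee_wpmul2l; rewrite ?lee_fin//.
  rewrite le_max; apply/orP; left; apply: ge_ereal_sup => _ [mu Pmu <-].
  apply: le_ereal_sup_tmp; exists (ereal_inf [set TV mu nu | nu in Q]).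
    by exists mu.
  apply: le_ereal_inf_tmp => _ [nu Qnu <-]; apply: ge_ereal_inf.
  exists (KL mu (mixture (one_half R) mu nu)).
    by exists (mixture (one_half R) mu nu) => //; exists mu => //; exists nu.
  by apply: KL_midpoint_le_TV => A _; exact: mixture_halfE.
rewrite le_max; apply/orP; right; apply: ge_ereal_sup => _ [nu Qnu <-].
apply: le_ereal_sup_tmp; exists (ereal_inf [set TV mu nu | mu in P]).
  by exists nu.
apply: le_ereal_inf_tmp => _ [mu Pmu <-]; apply: ge_ereal_inf.
exists (KL nu (mixture (one_half R) mu nu)).
  by exists (mixture (one_half R) mu nu) => //; exists mu => //; exists nu.
rewrite TV_sym; apply: KL_midpoint_le_TV => A _.
by rewrite addeC; exact: mixture_halfE.
Qed.

Lemma KL_set_ge0 P Q : P !=set0 -> 0 <= KL_set P Q.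
Proof.
move=> [mu Pmu]; apply: (@le_trans _ _ (ereal_inf [set KL mu nu | nu in Q])).
  by apply: le_ereal_inf_tmp => _ [nu _ <-]; exact: KL_ge0.
by apply: ereal_sup_ubound; exists mu.
Qed.

Lemma TV_set_ge0 P Q : P !=set0 -> 0 <= TV_set P Q.
Proof.
move=> [mu Pmu]; rewrite le_max; apply/orP; left.
apply: (@le_trans _ _ (ereal_inf [set TV mu nu | nu in Q])).
  by apply: le_ereal_inf_tmp => _ [nu _ <-]; exact: TV_ge0.
by apply: ereal_sup_ubound; exists mu.
Qed.

Lemma JS_set_ge0 P Q : P !=set0 -> Q !=set0 -> 0 <= JS_set P Q.
Proof. by move=> P0 Q0; rewrite adde_ge0// mule_ge0 ?lee_fin// KL_set_ge0. Qed.

(** If [mu'] is within [d] of [nu''] in [Q], then replacing [mu'] by [nu''] in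
    the midpoint of [mu'] and [nu'] costs only [d / 2] and lands in [Q] by
    convexity. The bound [d] thus becomes [e + d / 2]; starting from [1], which
    bounds every total variation distance, the iterates tend to the fixed point
    [2 e]. *)
Lemma approx_by_halving (P Q : set (probability T R)) (e : R) :
  Q !=set0 -> convex_probabilities Q ->
  (forall mu, P mu -> exists mu' nu', [/\ P mu', Q nu' &
     TV mu (mixture (one_half R) mu' nu') <= e%:E]) ->
  forall k mu, P mu -> exists2 nu, Q nu & TV mu nu <= (2 * e + 2^-1 ^+ k)%:E.
Proof.
move=> [nu0 Qnu0] convQ near_mid.
have e0 mu : P mu -> (0 <= e)%R.
  by move=> /near_mid[? [? [_ _ /(le_trans (TV_ge0 _ _))]]]; rewrite lee_fin.
elim=> [mu Pmu|k IHk mu Pmu].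
  exists nu0 => //; apply: le_trans (TV_le1 _ _) _.
  by rewrite expr0 lee_fin; have := e0 _ Pmu; lra.
have [mu' [nu' [Pmu' Qnu' le_e]]] := near_mid mu Pmu.
have [nu'' Qnu'' le_k] := IHk mu' Pmu'.
exists (mixture (one_half R) nu'' nu'); first exact: convQ.
apply: (le_trans (TV_triangle (mixture (one_half R) mu' nu') _ _)).
apply: (@le_trans _ _ (e%:E + 2^-1%:E * (2 * e + 2^-1 ^+ k)%:E)).
  apply: leeD => //; apply: le_trans (TV_mixture_half _ _ _) _.
  by apply: lee_wpmul2l; rewrite ?lee_fin.
by rewrite -EFinM -EFinD lee_fin exprS; lra.
Qed.

Lemma exists_expr_half_le (e : R) : (0 < e)%R ->
  exists k, (2^-1 ^+ k <= e :> R)%R.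
Proof.
move=> e0; exists (Num.bound e^-1).
rewrite exprVn -[leRHS]invrK lef_pV2 ?posrE ?invr_gt0 ?exprn_gt0//.
apply: le_trans (ltW (archi_boundP _)) _; first by rewrite invr_ge0 ltW.
by rewrite -natrX ler_nat ltnW// ltn_expl.
Qed.

(** The infimum over the midpoints need not be attained; a midpoint with
    [KL <= 3 s^2] exists, and [TV_le_KL] then gives [3 s + s]. *)
Lemma KL_set_midpoints (P Q S : set (probability T R)) (s : R) : (0 < s)%R ->
  KL_set S (midpoints P Q) <= (2 * s ^+ 2)%:E ->
  forall mu, S mu -> exists mu' nu', [/\ P mu', Q nu' &
    TV mu (mixture (one_half R) mu' nu') <= (4 * s)%:E].
Proof.
move=> s0 leKL mu Smu.
have : ereal_inf [set KL mu m | m in midpoints P Q] < (3 * s ^+ 2)%:E.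
  apply: le_lt_trans (_ : (2 * s ^+ 2)%:E < _); last first.
    by rewrite lte_fin ltr_pM2r ?exprn_gt0//; lra.
  by apply: le_trans leKL; apply: ereal_sup_ubound; exists mu.
move=> /ereal_inf_lt[_ [m [mu' Pmu' [nu' Qnu' <-]] <-]] /ltW /(TV_le_KL s0) le_s.
exists mu', nu'; split => //; apply: le_trans le_s _.
rewrite lee_fin expr2 mulrA mulfK ?gt_eqF//; lra.
Qed.

Lemma ereal_sup_inf_le (U V : Type) (f : U -> V -> \bar R) (A : set U)
    (B : set V) (e : \bar R) :
  (forall u, A u -> exists2 v, B v & f u v <= e) ->
  ereal_sup [set ereal_inf [set f u v | v in B] | u in A] <= e.
Proof.
move=> AB; apply: ge_ereal_sup => _ [u /AB[v Bv le_e] <-].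
by apply: ge_ereal_inf; exists (f u v) => //; exists v.
Qed.

(** [8 s] comes from [approx_by_halving] with [e = 4 s]; the ninth [s] absorbs
    the remainder [2^-k]. *)
Lemma TV_set_le_of_JS_set P Q (s : R) : (0 < s)%R ->
  P !=set0 -> Q !=set0 -> convex_probabilities P -> convex_probabilities Q ->
  JS_set P Q <= (s ^+ 2)%:E -> TV_set P Q <= (9 * s)%:E.
Proof.
move=> s0 P0 Q0 convP convQ leJS.
have [k lek] := exists_expr_half_le s0.
have le9 : (2 * (4 * s) + 2^-1 ^+ k <= 9 * s)%R by lra.
have double (x y : \bar R) : 0 <= y ->
    2^-1%:E * x + 2^-1%:E * y <= (s ^+ 2)%:E -> x <= (2 * s ^+ 2)%:E.
  move=> y0 le_s2; rewrite EFinM -lee_pdivrMl//; apply: le_trans le_s2.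
  by rewrite leeDl// mule_ge0 ?lee_fin.
have approx (A B : set (probability T R)) : B !=set0 -> convex_probabilities B ->
    (forall mu, A mu -> exists mu' nu', [/\ A mu', B nu' &
       TV mu (mixture (one_half R) mu' nu') <= (4 * s)%:E]) ->
    forall mu, A mu -> exists2 nu, B nu & TV mu nu <= (9 * s)%:E.
  move=> B0 convB near_mid mu Amu.
  have [nu Bnu le_nu] := approx_by_halving B0 convB near_mid k Amu.
  by exists nu => //; apply: le_trans le_nu _; rewrite lee_fin.
rewrite ge_max; apply/andP; split; apply: ereal_sup_inf_le.
  apply: approx => //; apply: KL_set_midpoints => //.
  by apply: double leJS; exact: KL_set_ge0.
move=> nu Qnu; have [|mu Pmu] := approx _ _ P0 convP _ nu Qnu.
  move=> nu1 Qnu1; have [|mu' [nu' [Pmu' Qnu' le_s]]] :=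
    KL_set_midpoints (P := P) (Q := Q) s0 _ Qnu1.
    by move: leJS; rewrite /JS_set addeC; apply: double; exact: KL_set_ge0.
  by exists nu', mu'; split => //; rewrite TV_mixture_halfC.
by rewrite TV_sym; exists mu.
Qed.
End divergences_of_sets.

(** * The equivalence *)

Lemma cvge_0P (R : realType) (u : nat -> \bar R) :
  (\forall n \near \oo, 0 <= u n)%E ->
  (u n @[n --> \oo] --> 0%E) <->
  (forall e : R, 0 < e -> \forall n \near \oo, (u n <= e%:E)%E).
Proof.
move=> u0; split=> [/fine_cvgP[ufin /cvgrPdist_le u_0] e e0|u_le].
  near=> n; rewrite -(@fineK _ (u n)); last by near: n.
  rewrite lee_fin; apply: le_trans (ler_norm _) _; rewrite -normrN -sub0r.
  by near: n; exact: u_0.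
apply/fine_cvgP; split.
  near=> n; rewrite ge0_fin_numE; last by near: n.
  by apply: (@le_lt_trans _ _ 1%:E); [near: n; exact: u_le|exact: ltry].
apply/cvgrPdist_le => e e0; near=> n.
have un0 : (0 <= u n)%E by near: n.
have une : (u n <= e%:E)%E by near: n; exact: u_le.
rewrite sub0r normrN ger0_norm ?fine_ge0// -lee_fin fineK//.
by rewrite ge0_fin_numE// (le_lt_trans une) ?ltry.
Unshelve. all: by end_near. Qed.

Theorem theorem8 (R : realType) (X : ptopologicalType) (hX : polish R X)
    (P : set (probability (borel X) R))
    (Pn : nat -> set (probability (borel X) R))
    (hP0 : P !=set0) (hPw : weakly_compact P) (hPc : convex_probabilities P)
    (hPn0 : forall n, (1 <= n)%N -> Pn n !=set0)
    (hPnw : forall n, (1 <= n)%N -> weakly_compact (Pn n))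
    (hPnc : forall n, (1 <= n)%N -> convex_probabilities (Pn n)) :
  (JS_set (Pn n) P @[n --> \oo] --> 0%E) <->
  (TV_set (Pn n) P @[n --> \oo] --> 0%E).
Proof.
have n_ge1 : \forall n \near \oo, (1 <= n)%N by exact: nbhs_infty_ge.
rewrite !cvge_0P; last 2 first.
- by apply: filterS n_ge1 => n n1; apply: TV_set_ge0; exact: hPn0.
- by apply: filterS n_ge1 => n n1; apply: JS_set_ge0 => //; exact: hPn0.
split=> small e e0; last first.
  by apply: filterS (small _ e0) => n; apply: le_trans; exact: JS_set_le_TV_set.
have s0 : 0 < e / 9 by rewrite divr_gt0.
apply: filterS2 n_ge1 (small _ (exprn_gt0 2 s0)) => n n1 JS_le.
rewrite (_ : e = 9 * (e / 9)); last by field.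
by apply: TV_set_le_of_JS_set => //; [exact: hPn0|exact: hPnc].
Qed.
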